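(* Let $n>k>t>j\ge1$ be integers with $n\ge(k-t+1)(t+1)$. Suppose that $\mathcal F\subset\binom{[n]}{k}$ is shifted and $t$-intersecting, $\mathcal F\not\subset\mathcal A_1$, and $b_{t+1}\ge t+1$. Then $$|\partial^j\mathcal F|>\binom{t}{j}|\mathcal F|.$$
   Context: $[n]=\{1,\dots,n\}$, and $\binom{[n]}{k}$ is the collection of all $k$-element subsets of $[n]$. A family $\mathcal F\subset\binom{[n]}{k}$ is $t$-intersecting if $|F\cap F'|\ge t$ for all $F,F'\in\mathcal F$. The $j$'th shadow is $\partial^j\mathcal F=\{G\in\binom{[n]}{k-j} : \exists F\in\mathcal F,\ G\subset F\}$. Shifted: for $k$-sets $A=\{a_1<\dots<a_k\}$, $B=\{b_1<\dots<b_k\}$ write $A\prec B$ iff $a_i\le b_i$ for all $1\le i\le k$; $\mathcal F$ is shifted if $A\prec B$ and $B\in\mathcal F$ always imply $A\in\mathcal F$. $\mathcal A_1=\{A\in\binom{[n]}{k}: |A\cap[t+2]|\ge t+1\}$. The base of $\mathcal F$ is $\mathcal B=\{F\cap[2k-t]:F\in\mathcal F\}$ (as a set of sets, without multiplicity), and $b_\ell=|\{B\in\mathcal B:|B|=\ell\}|$. *)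

(* Defs.v *)
From mathcomp Require Import all_boot.

Set Implicit Arguments.
Unset Strict Implicit.
Unset Printing Implicit Defensive.

(* The ground set [n] = {1, ..., n} is represented by 'I_n, where i : 'I_n
   stands for the integer i + 1; hence [m] is {i | i < m}. *)

Section Families.

Variable n : nat.

Implicit Types (A B G : {set 'I_n}) (F : {set {set 'I_n}}) (k t j l m : nat).

Definition segment m : {set 'I_n} := [set i : 'I_n | i < m].

Definition ksubsets k : {set {set 'I_n}} := [set A : {set 'I_n} | #|A| == k].

Definition t_intersecting t F : Prop :=
  forall A B, A \in F -> B \in F -> t <= #|A :&: B|.

(* Meant for families F of k-sets. *)
Definition shadow k j F : {set {set 'I_n}} :=
  [set G in ksubsets (k - j) | [exists A in F, G \subset A]].

(* [enum A] lists the elements of A in increasing order, and [all2] is false on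
   lists of different lengths: [prec A B] says that A = {a_1 < ... < a_k} and
   B = {b_1 < ... < b_k} have the same size k and a_i <= b_i for every i. *)
Definition prec A B : bool :=
  all2 (fun a b : 'I_n => a <= b) (enum A) (enum B).

Definition shifted F : Prop := forall A B, prec A B -> B \in F -> A \in F.

Definition frankl_A1 k t : {set {set 'I_n}} :=
  [set A in ksubsets k | t.+1 <= #|A :&: segment t.+2|].

Definition base k t F : {set {set 'I_n}} :=
  [set A :&: segment (2 * k - t) | A in F].

Definition base_count k t F l : nat := #|[set B in base k t F | #|B| == l]|.

End Families.

Arguments ksubsets : clear implicits.
Arguments frankl_A1 : clear implicits.

(* Main.v *)
(* By shiftedness, any two members of F meet in at least t elements of [2k-t].
   So the base sets of size t+1 pairwise share t elements and, there being at
   least t+1 >= 3 of them, either all lie in a set of size t+2, which shifting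
   forces to be [t+2] and which gives F \subset A_1, or all have the form
   [t] + x with x in a set P disjoint from [t], |P| >= t+1.  In the latter case a
   member A of F either contains [t], or misses a single y of [t] and contains P.
   The pairs (A, J), with A in F and J a j-subset of [t], then inject into the
   j-th shadow, separated by how much of [t] the image misses: send (A, J) to
   A \ J, unless A misses some y in [t] and J has an element z >= y; in that case,
   with d_0, d_1, ... the elements of P, send (A, J) to
   (A + y - d_y - d_(z+1)) \ (J - z); this lies in the shadow because A + y - d_y is
   in F by shifting, and the pair of missing petals encodes y <= z.  One more
   shadow set, meeting P in nothing and missing j-1 elements of [t], is not hit. *)

Require Import Defs.
From mathcomp Require Import all_boot zify.

Set Implicit Arguments.
Unset Strict Implicit.
Unset Printing Implicit Defensive.

(** Induction on both lists. At the threshold [v = y] the count hypothesis yields an entry of the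
    first list that is at most [y], so its minimum [x] is too. The hypothesis passes to the tails:
    for [y <= v] both heads are counted and cancel, and for [v < y] the tail of the second list
    contributes nothing. *)
Lemma all2_leq_sorted (s u : seq nat) :
  sorted ltn s -> sorted ltn u -> size s = size u ->
  (forall v, count (leq^~ v) u <= count (leq^~ v) s) ->
  all2 leq s u.
Proof.
elim: s u => [|x s IH] [|y u] //= pxs pyu [sz] cnt.
have allx : all (ltn x) s by apply: order_path_min pxs; apply: ltn_trans.
have ally : all (ltn y) u by apply: order_path_min pyu; apply: ltn_trans.
have le_xy : x <= y.
  have: 0 < count (leq^~ y) (x :: s) by apply: leq_trans (cnt y); rewrite /= leqnn.
  rewrite -has_count => /hasP[z]; rewrite inE => /predU1P[->//|zs] le_zy.
  by have /= := allP allx z zs; lia.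
rewrite le_xy; apply: IH => // [||v]; [exact: path_sorted pxs|exact: path_sorted pyu|].
have [le_yv|lt_vy] := leqP y v.
  by have := cnt v; rewrite le_yv (leq_trans le_xy le_yv).
rewrite (_ : count _ u = 0) //; apply/eqP; rewrite -leqn0 leqNgt -has_count.
by apply/hasPn => z zu; have /= := allP ally z zu; lia.
Qed.

(** The difference has at most one element. The conclusion is an equality of elements because later
    arguments exhibit two missed elements and identify them. *)
Lemma diff_at_most_one (U : finType) (A C : {set U}) t : #|A| = t.+1 -> t <= #|A :&: C| ->
  {in A :\: C &, forall u v, u = v}.
Proof.
move=> cA tAC.
have /card_le1_eqP le1 : #|A :\: C| <= 1 by have := cardsID C A; rewrite cA; lia.
by move=> u v uD vD; rewrite (le1 _ _ uD vD).
Qed.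

(** * Exchanges in shifted families, and intersections inside the segment [2k-t] *)

Section Shifting.

Variable n : nat.
Implicit Types (A B C G T : {set 'I_n}) (F : {set {set 'I_n}}).

Lemma sorted_enum_ord A : sorted ltn [seq val i | i <- enum A].
Proof.
have -> : enum A = [seq i <- enum 'I_n | i \in A] by rewrite enumT.
have srt: sorted ltn [seq val i | i <- enum 'I_n] by rewrite val_enum_ord iota_ltn_sorted.
rewrite sorted_map in srt; rewrite sorted_map; apply: sorted_filter => // y x z.
exact: ltn_trans.
Qed.

(** Counting below thresholds avoids tracking the positions of elements in [enum] when one element
    is exchanged. *)
Lemma prec_count A B : #|A| = #|B| ->
  (forall v : nat, #|[set b in B | b <= v]| <= #|[set a in A | a <= v]|) ->
  prec A B.
Proof.
move=> eqAB cnt.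
have cntE C (v : nat) : count (leq^~ v) [seq val i | i <- enum C] =
      #|[set c in C | c <= v]|.
  rewrite count_map cardE -size_filter; congr size.
  rewrite -[enum C]/(filter _ _) -filter_predI; apply: eq_filter => c /=.
  by rewrite inE andbC.
have -> : prec A B = all2 leq [seq val i | i <- enum A] [seq val i | i <- enum B].
  by rewrite /prec; elim: (enum A) (enum B) => [|a s IH] [|b u] //=; rewrite IH.
apply: all2_leq_sorted; rewrite ?sorted_enum_ord ?size_map -?cardE // => v.
by rewrite !cntE.
Qed.

Lemma card_exchange A (y z : 'I_n) :
  y \notin A -> z \in A -> #|y |: A :\ z| = #|A|.
Proof.
by move=> yA zA; rewrite cardsU1 !inE (negPf yA) andbF /= (cardsD1 z A) zA.
Qed.

Lemma prec_exchange A (y z : 'I_n) :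
  y \notin A -> z \in A -> y < z -> prec (y |: A :\ z) A.
Proof.
move=> yA zA lt_yz; apply: prec_count => [|v]; first exact: card_exchange.
set S := [set b in A | b <= v].
(* For [z <= v] both [y] and [z] lie below the threshold, so the count is unchanged; for [v < z] the
   removed element was not counted. *)
have [le_zv|lt_vz] := leqP z v.
  have -> : [set a in y |: A :\ z | a <= v] = y |: S :\ z.
    apply/setP=> i; rewrite !inE; case: eqP => [->|_] /=; last by rewrite andbA.
    by rewrite (leq_trans (ltnW lt_yz)).
  by rewrite card_exchange // !inE ?(negPf yA) // zA.
apply/subset_leq_card/subsetP => i; rewrite !inE => /andP[iA le_iv].
rewrite iA le_iv !andbT; case: (i =P z) => [eq_iz|_]; last by rewrite orbT.
by rewrite -eq_iz ltnNge le_iv in lt_vz.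
Qed.

Lemma shifted_exchange F A (y z : 'I_n) : shifted F ->
  A \in F -> y \notin A -> z \in A -> y < z -> y |: A :\ z \in F.
Proof. by move=> shF AF yA zA lt_yz; apply: shF AF; apply: prec_exchange. Qed.

Lemma card_segment m : m <= n -> #|segment n m| = m.
Proof.
move=> le_mn; rewrite -[RHS]card_ord -(card_imset predT (f := widen_ord le_mn)).
  apply: eq_card => i; rewrite inE; apply/idP/imsetP => [lt_im|[i' _ ->]].
    by exists (Ordinal lt_im) => //; apply: val_inj.
  exact: (ltn_ord i').
by move=> i i' /(congr1 val) eq_ii'; apply: val_inj.
Qed.

Lemma segment_exchange m A : m <= n -> #|A| = m -> A != segment n m ->
  exists y z, [/\ y \in segment n m, y \notin A, z \in A & y < z].
Proof.
move=> le_mn cA neqA.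
have /subsetPn[y yS yA] : ~~ (segment n m \subset A).
  by apply: contra neqA => sA; rewrite eq_sym eqEcard sA cA card_segment ?leqnn.
have /subsetPn[z zA zS] : ~~ (A \subset segment n m).
  by apply: contra neqA => sA; rewrite eqEcard sA cA card_segment ?leqnn.
exists y, z; split=> //; move: yS zS; rewrite !inE -leqNgt; exact: leq_trans.
Qed.

(** If A and B share a point p outside the segment, shift p in A to a point q of the segment outside
    both sets. The intersection with B loses p only, so its part inside the segment is unchanged,
    and induction on the size of the intersection applies. *)
Lemma t_intersecting_segment F k t A B :
  2 * k - t <= n -> F \subset ksubsets n k -> shifted F -> t_intersecting t F ->
  A \in F -> B \in F -> t <= #|A :&: B :&: segment n (2 * k - t)|.
Proof.
move=> le_n /subsetP unif shF intF; set S := segment n _.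
have [m] := ubnP #|A :&: B|; elim: m A => // m IH A lt_m AF BF.
have [sub|/subsetPn[p pAB pS]] := boolP (A :&: B \subset S).
  by rewrite (setIidPl sub); apply: intF.
have cardS : #|S| = 2 * k - t by apply: card_segment.
have cA : #|A| = k by have:= unif _ AF; rewrite inE => /eqP.
have cB : #|B| = k by have:= unif _ BF; rewrite inE => /eqP.
have tAB := intF _ _ AF BF.
(* The union has at most 2k-t elements, one of them p, so without p it cannot cover the 2k-t points
   of [S]. *)
have /subsetPn[q qS qAB] : ~~ (S \subset (A :|: B) :\ p).
  apply/negP=> /subset_leq_card; rewrite cardS.
  have := cardsUI A B; have := cardsD1 p (A :|: B).
  have -> : p \in A :|: B by rewrite inE (setIP pAB).1.
  by rewrite cA cB; lia.
have neq_qp : q != p by apply: contraNneq pS => <-.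
move: qAB; rewrite !inE neq_qp /= negb_or => /andP[qA qB].
have [pA pB] := setIP pAB.
have lt_qp : q < p by move: qS pS; rewrite !inE; lia.
have := IH (q |: A :\ p) _ (shifted_exchange shF AF qA pA lt_qp) BF.
have -> : (q |: A :\ p) :&: B = (A :&: B) :\ p.
  apply/setP=> i; rewrite !inE; case: (i =P q) => [->|_] /=; last by rewrite andbA.
  by rewrite (negPf qB) !andbF.
have -> : ((A :&: B) :\ p) :&: S = A :&: B :&: S.
  by apply/setP=> i; rewrite !inE; case: (i =P p) => [->|] //=;
    move: pS; rewrite inE => /negPf ->; rewrite !andbF.
apply; move: lt_m; rewrite (cardsD1 p (A :&: B)) pAB; lia.
Qed.

End Shifting.

(** * The strict shadow bound for a family with a star-shaped base *)

Section Star.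

Variables (n k t j : nat) (F : {set {set 'I_n}}) (P : {set 'I_n}).
Variables (A0 : {set 'I_n}) (x0 : 'I_n).
Let T := segment n t.
Hypotheses (lt_tk : t < k) (lt_kn : k < n) (lt_jt : j < t) (j_gt0 : 0 < j).
Hypotheses (F_unif : F \subset ksubsets n k) (F_shifted : shifted F).
Hypotheses (lt_tP : t < #|P|) (PT : [disjoint P & T]).
Hypothesis F_star : forall A y, A \in F -> y \in T :\: A -> (T :\ y) :|: P \subset A.
Hypotheses (A0F : A0 \in F) (TA0 : T \subset A0) (x0A0 : x0 \in A0 :\: T).
Hypothesis A0P : A0 :&: P \subset [set x0].

Implicit Types (A G J : {set 'I_n}) (y z : 'I_n).

(** The map below uses the indices y and z+1 with y, z < t; these are at most t < |P|, so the
    default [x0] is never returned. *)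
Definition petal (i : nat) : 'I_n := nth x0 (enum P) i.

Lemma petal_in i : i <= t -> petal i \in P.
Proof. by move=> le_it; rewrite -mem_enum mem_nth // -cardE (leq_ltn_trans le_it). Qed.

Lemma petal_inj i i' : i <= t -> i' <= t -> petal i = petal i' -> i = i'.
Proof.
move=> le_it le_it' /eqP.
by rewrite nth_uniq ?enum_uniq -?cardE ?(leq_ltn_trans _ lt_tP) // => /eqP.
Qed.

(** For A in F the missing y is unique by [F_star]. Any z in J with y <= z may be picked, since the
    image records it. The shift to z+1 keeps the two petals distinct when y = z. *)
Definition star_map (p : {set 'I_n} * {set 'I_n}) : {set 'I_n} :=
  let: (A, J) := p in
  if [pick y in T :\: A] is Some y then
    if [pick z in J | y <= z] is Some z then
      (((y |: A) :\ petal y) :\ petal z.+1) :\: (J :\ z)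
    else A :\: J
  else A :\: J.

Variant star_map_spec A J : {set 'I_n} -> Prop :=
  | StarFull of T \subset A : star_map_spec A J (A :\: J)
  | StarLow y of y \in T :\: A & {in J, forall z, z < y} : star_map_spec A J (A :\: J)
  | StarHigh y z of y \in T :\: A & z \in J & y <= z :
      star_map_spec A J ((((y |: A) :\ petal y) :\ petal z.+1) :\: (J :\ z)).

Lemma star_mapP A J : star_map_spec A J (star_map (A, J)).
Proof.
rewrite /star_map; case: pickP => [y yTA|noy]; last first.
  apply: StarFull; apply/subsetP=> y yT; apply: contraFT (noy y) => yA.
  by rewrite !inE yA; move: yT; rewrite inE.
case: pickP => [z /andP[zJ le_yz]|noz]; first exact: (@StarHigh _ _ y z).
apply: (@StarLow _ _ y) => // z zJ; rewrite ltnNge; apply: contraFN (noz z).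
by rewrite zJ.
Qed.

Definition star_dom := [set p : {set 'I_n} * {set 'I_n} |
  (p.1 \in F) && ((p.2 \subset T) && (#|p.2| == j))].

Lemma card_T : #|T| = t.
Proof. by apply: card_segment; move: lt_tk lt_kn; clear; lia. Qed.

Lemma card_star_dom : #|star_dom| = 'C(t, j) * #|F|.
Proof.
have -> : star_dom = setX F [set J : {set 'I_n} | J \subset T & #|J| == j].
  by apply/setP=> -[A J]; rewrite !inE.
by rewrite cardsX cards_draws card_T mulnC.
Qed.

(** This is the decoding table of [star_map]: for |J| = j the image misses j, j+1 or j-1 elements of
    T, which tells the three cases apart, and each case expresses A through the image and the other
    recovered data. *)
Lemma T_diff_star A J :
  A \in F -> J \subset T -> forall G, star_map_spec A J G ->
  [\/ T :\: G = J /\ A = G :|: J,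
      exists y, [/\ y \notin J, {in J, forall z, z < y}, T :\: G = y |: J & A = G :|: J]
    | exists y z, [/\ y < t, z < t, y <= z & z \in J] /\
        [/\ T :\: G = J :\ z, P :\: G = [set petal y; petal z.+1] &
            A = (G :|: (J :\ z) :|: [set petal y; petal z.+1]) :\ y]].
Proof.
move=> AF JT G [TA|y yTA ltJ|y z yTA zJ le_yz].
- have JA := subset_trans JT TA; constructor 1; split.
    apply/setP=> i; rewrite !inE negb_and negbK.
    have [iJ|_] := boolP (i \in J); first by have := subsetP JT i iJ; rewrite inE => ->.
    rewrite /=; apply/andP=> -[iA iT]; case/negP: iA; apply: (subsetP TA); by rewrite inE.
  apply/setP=> i; rewrite !inE; have [/(subsetP JA) ->|] := boolP (i \in J); by rewrite ?orbT ?orbF.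
- have := F_star AF yTA; rewrite subUset => /andP[TA _].
  have yJ : y \notin J by apply/negP=> /ltJ; rewrite ltnn.
  have JA : J \subset A.
    apply: subset_trans TA; apply/subsetP => i iJ; rewrite in_setD1 (subsetP JT) // andbT.
    by apply: contraNneq yJ => <-.
  move: yTA; rewrite inE => /andP[yA yT].
  constructor 2; exists y; split=> //.
    apply/setP=> i; rewrite in_setD in_setU1 in_setD negb_and negbK.
    have [->|neq_iy] := i =P y; first by rewrite yA orbT yT.
    have [iJ|_] := boolP (i \in J); first by rewrite (subsetP JT).
    rewrite /=; apply/andP=> -[iA iT]; case/negP: iA; apply: (subsetP TA).
    by rewrite in_setD1 iT andbT; apply/eqP.
  apply/setP=> i; rewrite !inE; have [/(subsetP JA) ->|] := boolP (i \in J); by rewrite ?orbT ?orbF.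
have := F_star AF yTA; rewrite subUset => /andP[/subsetP TA /subsetP PA].
have [yA yT] : y \notin A /\ y \in T by apply/andP; rewrite -in_setD.
have zT := subsetP JT z zJ.
have [lt_yt lt_zt] : y < t /\ z < t by move: yT zT; rewrite !inE.
have dy : petal y \in P by apply/petal_in/ltnW.
have dz : petal z.+1 \in P by apply: petal_in.
have [dyT dzT] : petal y \in T = false /\ petal z.+1 \in T = false.
  by rewrite !(disjointFr PT).
have JT' i : i \in J -> i \in T by apply: (subsetP JT).
constructor 3; exists y, z; split=> //; split.
- apply/setP=> i; rewrite !(in_setD1, in_setU1, in_setD, in_set1) !negb_and !negbK.
  have [iT|iNT] /= := boolP (i \in T); last first.
    by rewrite andbF; apply/esym/negP=> /andP[_ /JT']; apply/negP.
  rewrite andbT.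
  have -> : i == petal z.+1 = false by apply: contraTF iT => /eqP ->; rewrite dzT.
  have -> : i == petal y = false by apply: contraTF iT => /eqP ->; rewrite dyT.
  have -> : (i == y) || (i \in A)
    by case: eqP => //= neq_iy; apply: TA; rewrite in_setD1 iT andbT; apply/eqP.
  by rewrite orbF negb_or negbK.
- apply/setP=> i; rewrite !(in_setD1, in_setU1, in_setD, in_set1) !negb_and !negbK.
  have [->|_] := i =P petal y; first by rewrite dy !orbT.
  have [->|_] := i =P petal z.+1; first by rewrite dz !orbT.
  have [iP|] /= := boolP (i \in P); last by rewrite andbF.
  rewrite (PA _ iP) orbT /= orbF andbT negb_or negbK; apply/negP=> /andP[_ /JT'].
  by rewrite (disjointFr PT).
apply/setP=> i; rewrite !(in_setD1, in_setU1, in_setU, in_setD, in_set1).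
have [->|neq_iy] /= := i =P y; first exact: negbTE.
have [->|_] /= := i =P petal y; first by rewrite (PA _ dy) !orbT.
have [->|_] /= := i =P petal z.+1; first by rewrite (PA _ dz) !orbT.
rewrite orbF; have [|iJz] /= := boolP ((i != z) && (i \in J)); last by rewrite orbF.
by move=> /andP[_ /JT' iT]; rewrite TA // in_setD1 iT andbT; apply/eqP.
Qed.

Lemma star_map_inj : {in star_dom &, injective star_map}.
Proof.
move=> [A J] [A' J'] pD pD' eqG; move: pD pD'; rewrite !inE /=.
move=> /and3P[AF JT /eqP cJ] /and3P[AF' JT' /eqP cJ'].
have := T_diff_star AF JT (star_mapP A J); have := T_diff_star AF' JT' (star_mapP A' J').
rewrite -eqG; set G := star_map _.
have cD z (K : {set 'I_n}) : z \in K -> #|K| = #|K :\ z|.+1 by move=> zK; rewrite (cardsD1 z) zK.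
case=> [[eJ' ->]|[y' [yJ' lt' eJ' ->]]|[y' [z' [[lty' ltz' le' zJ'] [eJ' eP' ->]]]]];
case=> [[eJ ->]|[y [yJ lt eJ ->]]|[y [z [[lty ltz le zJ] [eJ eP ->]]]]].
- by rewrite -eJ -eJ'.
- by have := cardsU1 y J; rewrite -eJ eJ' yJ cJ cJ' => /n_Sn.
- by have := cD _ _ zJ; rewrite -eJ eJ' cJ cJ' => /n_Sn.
- by have := cardsU1 y' J'; rewrite -eJ' eJ yJ' cJ cJ' => /n_Sn.
(* Both are the largest element of T missed by the common image. *)
- have eq_yy' : y = y'.
    apply/eqP/negPn/negP => neq_yy'.
    have := setU11 y J; rewrite -eJ eJ' in_setU1 (negPf neq_yy') /= => /lt' lt1.
    have := setU11 y' J'; rewrite -eJ' eJ in_setU1 eq_sym (negPf neq_yy') /= => /lt /(ltn_trans lt1).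
    by rewrite ltnn.
  suff -> : J = J' by [].
  by rewrite -(setU1K yJ) -eJ eJ' eq_yy' setU1K.
- by have := cD _ _ zJ; rewrite -eJ eJ' cardsU1 yJ' cJ cJ'; clear; lia.
- by have := cD _ _ zJ'; rewrite -eJ' eJ cJ cJ' => /n_Sn.
- by have := cD _ _ zJ'; rewrite -eJ' eJ cardsU1 yJ cJ cJ'; clear; lia.
(* Equal petal pairs give {y, z+1} = {y', z'+1}; since y < z+1 and y' < z'+1, the smaller indices
   agree and so do the larger ones. *)
have E1 : petal y \in [set petal y'; petal z'.+1] by rewrite -eP' eP set21.
have E2 : petal z.+1 \in [set petal y'; petal z'.+1] by rewrite -eP' eP set22.
have E3 : petal y' \in [set petal y; petal z.+1] by rewrite -eP eP' set21.
have [lety letz lety' letz'] := And4 (ltnW lty) ltz (ltnW lty') ltz'.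
have H1 : (y : nat) = y' \/ (y : nat) = z'.+1.
  by case/set2P: E1 => /petal_inj ->; [left| | |right| |].
have H2 : z.+1 = y' \/ z.+1 = z'.+1.
  by case/set2P: E2 => /petal_inj ->; [left| | |right| |].
have H3 : (y' : nat) = y \/ (y' : nat) = z.+1.
  by case/set2P: E3 => /petal_inj ->; [left| | |right| |].
have [] : (y : nat) = y' /\ (z : nat) = z' by move: H1 H2 H3 le le'; clear; lia.
move=> /val_inj eq_y /val_inj eq_z.
by rewrite -(setD1K zJ) -(setD1K zJ') -eJ -eJ' eq_y eq_z.
Qed.

Lemma subset_shadow A G : A \in F -> G \subset A -> #|G| = k - j -> G \in shadow k j F.
Proof.
move=> AF GA cG; rewrite !inE cG eqxx; apply/existsP; exists A.
by rewrite AF.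
Qed.

Lemma star_map_shadow p : p \in star_dom -> star_map p \in shadow k j F.
Proof.
case: p => A J; rewrite [_ \in star_dom]inE => /and3P[AF JT /eqP cJ].
rewrite /= in AF JT cJ.
have cardF B : B \in F -> #|B| = k by move=> /(subsetP F_unif); rewrite inE => /eqP.
have lowJ B : B \in F -> J \subset B -> B :\: J \in shadow k j F.
  move=> BF JB; apply: (subset_shadow BF); first exact: subsetDl.
  by rewrite cardsD (setIidPr JB) cJ cardF.
case: (star_mapP A J) => [TA|y yTA ltJ|y z yTA zJ le_yz].
- exact: lowJ (subset_trans JT TA).
- apply: lowJ => //; have := F_star AF yTA; rewrite subUset => /andP[TA _].
  apply: subset_trans TA; apply/subsetP => i iJ; rewrite in_setD1 (subsetP JT) // andbT.
  by apply: contraTneq (ltJ _ iJ) => ->; rewrite ltnn.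
have := F_star AF yTA; rewrite subUset => /andP[/subsetP TA /subsetP PA].
have [yA yT] : y \notin A /\ y \in T by apply/andP; rewrite -in_setD.
have zT := subsetP JT z zJ.
have [lt_yt lt_zt] : y < t /\ z < t by move: yT zT; rewrite !inE.
have dy : petal y \in P by apply/petal_in/ltnW.
have dz : petal z.+1 \in P by apply: petal_in.
have [dyT dzT] : petal y \in T = false /\ petal z.+1 \in T = false.
  by rewrite !(disjointFr PT).
have neq_d : petal z.+1 != petal y.
  by apply/eqP=> /petal_inj -/(_ lt_zt (ltnW lt_yt)); move: le_yz; clear; lia.
have neq_yd : y != petal y by apply: contraTneq yT => ->; rewrite dyT.
(* A petal lies outside T = [t], hence beyond y, so this is a downward exchange. *)
have BF : y |: A :\ petal y \in F.
  apply: shifted_exchange => //; first exact: PA.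
  by apply: leq_trans lt_yt _; move/negbT: dyT; rewrite inE -leqNgt.
have eqB : (y |: A) :\ petal y = y |: A :\ petal y.
  by apply/setP=> i; rewrite !(in_setD1, in_setU1); have [->|] := i =P y; rewrite ?neq_yd.
rewrite eqB; set B := y |: _ in BF *.
have dzB : petal z.+1 \in B by rewrite in_setU1 in_setD1 neq_d PA ?orbT.
have JB : J :\ z \subset B :\ petal z.+1.
  apply/subsetP=> i; rewrite !in_setD1 in_setU1 in_setD1 => /andP[neq_iz /(subsetP JT) iT].
  have -> : i != petal z.+1 by apply: contraTneq iT => ->; rewrite dzT.
  have -> : i != petal y by apply: contraTneq iT => ->; rewrite dyT.
  have [//|neq_iy] /= := i =P y; by apply: TA; rewrite in_setD1 iT andbT; apply/eqP.
(* From the k elements of [B] one petal and the j-1 elements of J - z are removed, which leaves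
   k-j. *)
apply: (subset_shadow BF); first by rewrite subDset subsetU // subD1set orbT.
rewrite cardsD (setIidPr JB).
have := cardsD1 z J; have := cardsD1 (petal z.+1) B; rewrite zJ dzB (cardF B) // cJ.
by rewrite !add1n => -> ->; rewrite subSS.
Qed.

Lemma star_shadow : 'C(t, j) * #|F| < #|shadow k j F|.
Proof.
have [J0 J0T cJ0] : exists2 J0 : {set 'I_n}, J0 \subset T & #|J0| = j.-1.
  have : 0 < #|[set J : {set 'I_n} | J \subset T & #|J| == j.-1]|.
    by rewrite cards_draws card_T bin_gt0; move: lt_jt; clear; lia.
  by case/card_gt0P=> J; rewrite inE => /andP[? /eqP ?]; exists J.
have [x0A x0T] : x0 \in A0 /\ x0 \in T = false.
  by move: x0A0; rewrite in_setD => /andP[/negbTE].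
have cA0 : #|A0| = k by have := subsetP F_unif _ A0F; rewrite inE => /eqP.
(* The extra shadow set. It misses only j-1 elements of T, so only the third case of the map could
   produce it; there all but two petals would remain, whereas [G0] contains none of the at least
   three. *)
pose G0 := (A0 :\ x0) :\: J0.
have J0A : J0 \subset A0 :\ x0.
  apply: subset_trans J0T _; apply/subsetP => i iT; rewrite in_setD1 (subsetP TA0) // andbT.
  by apply: contraTneq iT => ->; rewrite x0T.
have G0sh : G0 \in shadow k j F.
  apply: (subset_shadow A0F); first by rewrite subDset subsetU // subD1set orbT.
  rewrite cardsD (setIidPr J0A) cJ0; have := cardsD1 x0 A0; rewrite x0A cA0 add1n => ->.
  by rewrite -[in RHS](prednK j_gt0) subSS.
have TG0 : T :\: G0 = J0.
  apply/setP=> i; rewrite !(in_setD, in_set1) negb_and negbK.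
  have [iJ|_] /= := boolP (i \in J0); first by rewrite (subsetP J0T).
  apply/andP=> -[iA iT]; case/negP: iA; rewrite (subsetP TA0) // andbT.
  by apply: contraTneq iT => ->; rewrite x0T.
have G0N : G0 \notin star_map @: star_dom.
  apply/imsetP => -[[A J]]; rewrite inE => /and3P[AF JT /eqP cJ] eqG.
  rewrite /= in AF JT cJ.
  have := T_diff_star AF JT (star_mapP A J); rewrite -eqG TG0.
  case=> [[eJ _]|[y [yJ _ eJ _]]|[y [z [[lty ltz le zJ] [eJ eP _]]]]].
  - by move: cJ j_gt0; rewrite -eJ cJ0; clear; lia.
  - by have := cardsU1 y J; rewrite -eJ yJ cJ0 cJ; clear; lia.
  have PG0 : P :\: G0 = P.
    apply/setP=> i; rewrite !(in_setD, in_set1).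
    have [iP|] := boolP (i \in P); rewrite ?andbF // andbT.
    apply/negP=> /and3P[_ neq_ix iA].
    have := subsetP A0P i; rewrite in_setI iA iP in_set1 => /(_ isT) eq_ix.
    by rewrite eq_ix in neq_ix.
  have : #|P| <= 2 by rewrite -PG0 eP cards2; case: (_ == _).
  by move: lt_tP lt_jt j_gt0; clear; lia.
rewrite -card_star_dom -(card_in_imset star_map_inj).
apply: proper_card; apply/properP; split; last by exists G0.
by apply/subsetP => G /imsetP[p pD ->]; apply: star_map_shadow.
Qed.

End Star.

(** Take distinct B1, B2 with common part K. If some B3 omits a point of K, it must contain both x1
    and x2, the points where B1 and B2 differ. A member B with a point u outside B1 + x2 would be K
    + u, and B3 would then have two points outside B. *)
Lemma near_star_or_clique (U : finType) (E : {set {set U}}) t :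
  1 < #|E| -> (forall B, B \in E -> #|B| = t.+1) ->
  (forall B C, B \in E -> C \in E -> t <= #|B :&: C|) ->
  (exists2 K : {set U}, #|K| = t & (forall B, B \in E -> K \subset B)) \/
  (exists2 W : {set U}, #|W| = t.+2 & (forall B, B \in E -> B \subset W)).
Proof.
move=> /card_gt1P[B1 [B2 [B1E B2E neq12]]] cE intE.
have le1 B C : B \in E -> C \in E -> {in B :\: C &, forall u v, u = v}.
  by move=> BE CE; apply: (diff_at_most_one (cE _ BE) (intE _ _ BE CE)).
have diff B C : B \in E -> C \in E -> B != C -> exists2 x, x \in B & x \notin C.
  move=> BE CE neqBC; apply/subsetPn; apply: contra neqBC => sBC.
  by rewrite eqEcard sBC (cE B) ?(cE C) /=.
have [x1 x1B1 x1B2] := diff _ _ B1E B2E neq12.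
have [x2 x2B2 x2B1] : exists2 x, x \in B2 & x \notin B1 by apply: diff; rewrite // eq_sym.
pose K := B1 :\ x1.
have cK : #|K| = t by have := cardsD1 x1 B1; rewrite x1B1 (cE B1) // add1n => -[->].
have [/forall_inP allK|] := boolP [forall B in E, K \subset B]; first by left; exists K.
rewrite negb_forall_in => /exists_inP[B3 B3E /subsetPn[w wK wB3]].
right; exists (x2 |: B1); first by rewrite cardsU1 x2B1 (cE B1).
have [neq_wx1 wB1] : w != x1 /\ w \in B1 by apply/andP; rewrite -in_setD1.
have KB2 i : i \in K -> i \in B2.
  rewrite in_setD1 => /andP[neq_i iB1]; apply: contraNT neq_i => iB2.
  by apply/eqP/(le1 B1 B2) => //; rewrite in_setD ?iB2 ?x1B2.
have x1B3 : x1 \in B3.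
  apply: contraNT neq_wx1 => x1B3.
  by apply/eqP/(le1 B1 B3) => //; rewrite in_setD ?wB3 ?x1B3.
have x2B3 : x2 \in B3.
  apply: contraNT x2B1 => x2B3; have -> : x2 = w; last by [].
  by apply: (le1 B2 B3) => //; rewrite in_setD ?wB3 ?x2B3 ?(KB2 _ wK).
move=> B BE; apply/subsetP => u uB; rewrite in_setU1; apply/negPn/negP.
rewrite negb_or => /andP[neq_ux2 uB1].
have uB2 : u \notin B2.
  apply: contra uB1 => uB2; apply: contraNT neq_ux2 => uB1.
  by apply/eqP/(le1 B2 B1) => //; rewrite in_setD ?uB1 ?x2B1.
have BuK : B :\ u = K.
  apply/eqP; rewrite eqEcard cK; apply/andP; split; last first.
    by have := cardsD1 u B; rewrite uB (cE B) // add1n => -[<-].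
  apply/subsetP => i; rewrite in_setD1 => /andP[neq_iu iB].
  have iB1 : i \in B1.
    apply: contraNT neq_iu => iB1.
    by apply/eqP/(le1 B B1) => //; rewrite in_setD ?uB1 ?iB1.
  rewrite in_setD1 iB1 andbT; apply: contraNneq x1B2 => <-.
  apply: contraNT neq_iu => iB2.
  by apply/eqP/(le1 B B2) => //; rewrite in_setD ?uB2 ?iB2.
have neq_x12 : x1 != x2 by apply: contraNneq x1B2 => ->.
have x1B : x1 \notin B.
  have := setD11 x1 B1; rewrite -/K -BuK in_setD1.
  have -> : x1 != u by apply: contraNneq uB1 => <-.
  by move=> /= ->.
have x2B : x2 \notin B.
  have : x2 \notin K by rewrite in_setD1 (negPf x2B1) andbF.
  by rewrite -BuK in_setD1 eq_sym neq_ux2.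
case/eqP: neq_x12; apply: (le1 B3 B) => //; by rewrite in_setD ?x1B ?x2B.
Qed.

(** * The base sets of size t+1: clique case and star case *)

Section Structure.

Variables (n k t : nat) (F : {set {set 'I_n}}).
Let S := segment n (2 * k - t).
Let T := segment n t.
Let E := [set B in base k t F | #|B| == t.+1].
Hypotheses (lt_tk : t < k) (le_n : 2 * k - t <= n).
Hypotheses (F_unif : F \subset ksubsets n k) (F_shifted : shifted F).
Hypothesis F_int : t_intersecting t F.
Implicit Types (A B C K W : {set 'I_n}).

Lemma base_level_lift B : B \in E ->
  exists2 A, A \in F & [/\ #|B| = t.+1, B \subset S & forall i, i \in S -> (i \in A) = (i \in B)].
Proof.
rewrite inE => /andP[/imsetP[A AF eqB] /eqP cB]; exists A => //; split=> //.
  by rewrite eqB subsetIr.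
by move=> i iS; rewrite eqB in_setI iS andbT.
Qed.

Lemma base_level_miss A B : B \in E -> A \in F -> {in B :\: A &, forall u v, u = v}.
Proof.
move=> BE AF; have [A' A'F [cB BS memB]] := base_level_lift BE.
apply: (diff_at_most_one cB).
have -> : B :&: A = A' :&: A :&: S.
  apply/setP=> i; rewrite !in_setI; have [iS|iS] := boolP (i \in S).
    by rewrite memB // andbT.
  by rewrite andbF; apply/negbTE/nandP; left; apply: contra iS; apply/subsetP.
exact: (t_intersecting_segment le_n F_unif F_shifted F_int A'F AF).
Qed.

Lemma base_level_int B C : B \in E -> C \in E -> t <= #|B :&: C|.
Proof.
move=> BE CE; have [A AF [cB BS memB]] := base_level_lift BE.
have [A' A'F [cC CS memC]] := base_level_lift CE.
apply: leq_trans (t_intersecting_segment le_n F_unif F_shifted F_int AF A'F) _.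
apply/subset_leq_card/subsetP => i; rewrite !in_setI => /andP[/andP[iA iA'] iS].
by rewrite -memB // -memC // iA iA'.
Qed.

(** Every A in F misses at most one point of W, and shiftedness forces W = [t+2]; together these
    give |A meet [t+2]| >= t+1. *)
Lemma clique_frankl_A1 W :
  2 < #|E| -> #|W| = t.+2 -> (forall B, B \in E -> B \subset W) -> F \subset frankl_A1 n k t.
Proof.
move=> cE cW EW.
have le_tn : t.+2 <= 2 * k - t by move: lt_tk; clear; lia.
have missW A : A \in F -> {in W :\: A &, forall u v, u = v}.
  move=> AF u v; rewrite !in_setD => /andP[uA uW] /andP[vA vW].
  (* Each member of [E] is W minus one point. If A missed both u and v, none could contain both,
     leaving only W - u and W - v, against |E| >= 3. *)
  apply/eqP/negPn/negP => neq_uv.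
  have : E \subset [set W :\ u; W :\ v].
    apply/subsetP=> B BE; have [_ _ [cB _ _]] := base_level_lift BE.
    have eqW w : w \in W -> w \notin B -> B = W :\ w.
      move=> wW wB; apply/eqP; rewrite eqEcard subsetD1 EW // wB cB /=.
      by have := cardsD1 w W; rewrite wW cW add1n => -[->].
    have [uB|uB] := boolP (u \in B); last by rewrite (eqW u) // set21.
    have [vB|vB] := boolP (v \in B); last by rewrite (eqW v) // set22.
    by case/eqP: neq_uv; apply: (base_level_miss BE AF); rewrite in_setD ?uA ?vA.
  move=> /subset_leq_card; rewrite cards2 leqNgt; case/negP.
  by apply: leq_trans cE; case: (_ == _).
have coverW w : w \in W -> exists2 B, B \in E & w \in B.
  move=> wW; have /subsetPn[B BE] : ~~ (E \subset [set W :\ w]).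
    by apply/negP=> /subset_leq_card; rewrite cards1; move: cE; clear; lia.
  rewrite in_set1 => neqB; exists B => //; have [_ _ [cB _ _]] := base_level_lift BE.
  apply: contraNT neqB => wB; rewrite eqEcard subsetD1 EW // wB cB /=.
  by have := cardsD1 w W; rewrite wW cW add1n => -[->].
have eqW : W = segment n t.+2.
  apply/eqP/negPn/negP => neqW.
  have [y [z [yS yW zW lt_yz]]] := segment_exchange (leq_trans le_tn le_n) cW neqW.
  have [B BE zB] := coverW z zW.
  have [A AF [cB BS memB]] := base_level_lift BE.
  have /subsetPn[w wW wB] : ~~ (W \subset B).
    by apply/negP=> /subset_leq_card; rewrite cW cB ltnn.
  have yA : y \notin A.
    rewrite memB; first by apply: contra yW; apply/subsetP/EW.
    by move: yS; rewrite !inE => /leq_trans; apply.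
  have zA : z \in A by rewrite memB // (subsetP BS).
  have wA : w \notin A.
    have [B' /base_level_lift[_ _ [_ B'S _]] wB'] := coverW w wW.
    by rewrite memB // (subsetP B'S).
  (* A already misses w; after z is replaced by y, which is not in W, the new member misses the two
     points w and z of W. *)
  have A'F := shifted_exchange F_shifted AF yA zA lt_yz.
  have neq_zy : z != y by apply: contraNneq yW => <-.
  have neq_wy : w != y by apply: contraNneq yW => <-.
  case/negP: wB; have -> : w = z; last by [].
  by apply: (missW _ A'F);
    rewrite in_setD in_setU1 in_setD1 ?wW ?zW ?(negPf wA) ?eqxx ?(negPf neq_zy) ?(negPf neq_wy) ?andbF.
apply/subsetP=> A AF; rewrite !inE.
have := subsetP F_unif _ AF; rewrite inE => -> /=; rewrite -eqW.
have le1 : #|W :\: A| <= 1 by apply/card_le1_eqP => u v uD vD; apply: (missW A).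
by rewrite -(leq_add2r 1) addn1 -cW -(cardsID A W) setIC leq_add2l.
Qed.

(** Distinct members of [E] have distinct petals over K. If K were not [t], shifting a point z of K
    down to y in a member with trace x + K would give a member missing z; it would also miss any
    petal x' other than x and y, hence two points of x' + K. So only two petals could exist. *)
Lemma star_petals K :
  2 < #|E| -> #|K| = t -> (forall B, B \in E -> K \subset B) ->
  exists P : {set 'I_n}, [/\ #|E| <= #|P|, [disjoint P & T], P \subset S &
    forall x, x \in P -> x |: T \in E].
Proof.
move=> cE cK EK; pose P := [set x | (x \notin K) && (x |: K \in E)].
have cP : #|E| <= #|P|.
  apply: leq_trans (leq_imset_card (fun x => x |: K) P).
  apply/subset_leq_card/subsetP => B BE.
  have [_ _ [cB _ _]] := base_level_lift BE.
  have /subsetPn[x xB xK] : ~~ (B \subset K).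
    by apply/negP=> /subset_leq_card; rewrite cK cB ltnn.
  have eqB : x |: K = B.
    by apply/eqP; rewrite eqEcard subUset sub1set xB EK // cardsU1 xK cK cB /=.
  by apply/imsetP; exists x; rewrite ?eqB // /P inE xK eqB.
have PS : P \subset S.
  apply/subsetP=> x; rewrite inE => /andP[_ /base_level_lift[A _ [_ /subsetP BS _]]].
  exact/BS/setU11.
suff eqK : K = T.
  exists P; rewrite -eqK; split=> //.
    by rewrite disjoint_subset; apply/subsetP=> x; rewrite !inE => /andP[].
  by move=> x; rewrite inE => /andP[].
apply/eqP/negPn/negP => neqK.
have le_t : t <= 2 * k - t by move: lt_tk; clear; lia.
have [y [z [yT yK zK lt_yz]]] := segment_exchange (leq_trans le_t le_n) cK neqK.
have /subsetPn[x xP] : ~~ (P \subset [set y]).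
  by apply/negP=> /subset_leq_card; rewrite cards1; move: cE cP; clear; lia.
rewrite in_set1 => neq_xy.
have [xK xE] : x \notin K /\ x |: K \in E by move: xP; rewrite inE => /andP.
have [A AF [cB BS memB]] := base_level_lift xE.
have yS : y \in S by move: yT; rewrite !inE => /leq_trans; apply.
have yA : y \notin A by rewrite memB // in_setU1 negb_or eq_sym neq_xy.
have zA : z \in A by rewrite memB ?(subsetP BS) // in_setU1 zK orbT.
have A'F := shifted_exchange F_shifted AF yA zA lt_yz.
have : P \subset [set x; y].
  apply/subsetP=> x' x'P; rewrite in_set2; apply/negPn/negP.
  rewrite negb_or => /andP[neq_x neq_y].
  have [x'K x'E] : x' \notin K /\ x' |: K \in E by move: x'P; rewrite inE => /andP.
  have x'S : x' \in S by apply: (subsetP PS).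
  have : z = x'; last by move=> eq_z; rewrite -eq_z zK in x'K.
  apply: (base_level_miss x'E A'F); rewrite in_setD !in_setU1 !in_setD1.
    by rewrite eqxx zK orbT andbT orbF; move: lt_yz; clear; case: eqP => // ->; rewrite ltnn.
  by rewrite eqxx (negPf neq_y) memB // in_setU1 (negPf neq_x) (negPf x'K) andbF.
move=> /subset_leq_card; rewrite cards2; apply/negP; rewrite -ltnNge.
by apply: leq_trans (leq_trans cE cP); case: (_ == _).
Qed.

End Structure.

Theorem theorem6p7 (n k t j : nat) (F : {set {set 'I_n}})
    (lt_kn : k < n) (lt_tk : t < k) (lt_jt : j < t) (j_ge1 : 1 <= j)
    (n_ge : (k - t + 1) * (t + 1) <= n)
    (F_unif : F \subset ksubsets n k)
    (F_shifted : shifted F)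
    (F_int : t_intersecting t F)
    (F_notA1 : ~~ (F \subset frankl_A1 n k t))
    (F_base : t + 1 <= base_count k t F (t + 1)) :
  'C(t, j) * #|F| < #|shadow k j F|.
Proof.
(* Since t+1 >= 2, the product (k-t+1)(t+1) is at least 2(k-t) + t = 2k-t. *)
have le_n : 2 * k - t <= n.
  apply: leq_trans n_ge; move: lt_tk lt_jt j_ge1; clear.
  move=> lt_tk lt_jt j_ge1; have -> : 2 * k - t = (k - t) * 2 + t by lia.
  by nia.
rewrite /base_count !addn1 in F_base; set E := [set B in _ | _] in F_base.
have cE : 2 < #|E| by apply: leq_trans F_base; move: lt_jt j_ge1; clear; lia.
have [] := @near_star_or_clique _ E t (ltnW cE).
- by move=> B; rewrite inE => /andP[_ /eqP].
- exact: base_level_int.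
- move=> [K cK EK].
  have [P [cP PT PS PE]] := star_petals lt_tk le_n F_unif F_shifted F_int cE cK EK.
  have [x0 x0P] : exists x, x \in P by apply/card_gt0P; apply: leq_trans cP; apply: ltnW (ltnW cE).
  have x0T : x0 \in segment n t = false := disjointFr PT x0P.
  (* [A0] has trace [t] + [x0] on [2k-t]; as P lies in that segment, [x0] is its only petal. *)
  have x0E := PE _ x0P; have [A0 A0F [_ BS memB]] := base_level_lift x0E.
  apply: (@star_shadow n k t j F P A0 x0) => //.
  + exact: leq_trans F_base cP.
  (* A member misses at most one point of each [t] + x. Once y is missed, comparison with [t] + [x0]
     gives the rest of [t], and comparison with [t] + x gives each petal x. *)
  + move=> A y AF; rewrite in_setD => /andP[yA yT]; rewrite subUset; apply/andP; split.
      apply/subsetP=> i; rewrite in_setD1 => /andP[neq_iy iT].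
      apply: contraNT neq_iy => iA; apply/eqP.
      apply: (base_level_miss le_n F_unif F_shifted F_int x0E AF);
        by rewrite in_setD in_setU1 ?iA ?yA ?iT ?yT orbT.
    apply/subsetP=> x xP; have xT := disjointFr PT xP.
    rewrite -[_ \in _]negbK; apply/negP => xA.
    have eq_xy : x = y.
      apply: (base_level_miss le_n F_unif F_shifted F_int (PE _ xP) AF);
        by rewrite in_setD in_setU1 ?xA ?yA ?eqxx ?yT ?orbT.
    by rewrite eq_xy yT in xT.
  + apply/subsetP=> i iT; have iB : i \in x0 |: segment n t by rewrite in_setU1 iT orbT.
    by rewrite memB // (subsetP BS).
  + by rewrite in_setD x0T memB ?(subsetP PS) // setU11.
  + apply/subsetP=> i; rewrite in_setI in_set1 => /andP[iA iP].
    by move: iA; rewrite memB ?(subsetP PS) // in_setU1 (disjointFr PT iP) orbF.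
move=> [W cW EW]; case/negP: F_notA1.
exact: (clique_frankl_A1 lt_tk le_n F_unif F_shifted F_int cE cW EW).
Qed.
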